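(* Let $\mathfrak k$ be a curved Lie algebra with curvature $\Omega$ and predifferential $d$, with a complete Hausdorff descending filtration $\mathfrak k=F_1\supset F_2\supset\cdots$. An element $\xi_n\in\mathrm{MC}(\mathfrak k/F_{n+1})$ at level $n$ lifts to an element $\xi_{n+1}\in\mathrm{MC}(\mathfrak k/F_{n+2})$ at level $n+1$ if and only if the obstruction $\Omega+\Omega^{\xi_n}$ at level $n+1$, which is a cocycle in $C^2_{n+1}(\mathfrak k)$, vanishes as a cohomology class in $H^2_{n+1}(\mathfrak k)$.
   Context: The base field $k$ is normally $\mathbb Q$. A curved Lie algebra is a graded Lie algebra $\mathfrak k$ with a degree $2$ element $\Omega$ (curvature) and a degree $1$ derivation $d$ (predifferential) with $d^2\eta=[\eta,\Omega]$ for all $\eta$ and $d\Omega=0$. $\mathrm{MC}(\mathfrak k)$ is the set of degree $1$ elements $\xi$ with $\Omega+d\xi+\frac12[\xi,\xi]=0$. For a degree $1$ element $\xi$, $\Omega^\xi=d\xi+\frac12[\xi,\xi]$. A filtration of a curved Lie algebra is a descending filtration by subspaces with $[F_p,F_q]\subset F_{p+q}$ and $d(F_n)\subset F_n$; it is Hausdorff if $\bigcap F_i=0$ and complete if $\mathfrak k=\varprojlim\mathfrak k/F_i$. Here $\mathfrak k=F_0=F_1$. $C_n^\bullet(\mathfrak k)$ is the graded space $F_n/F_{n+1}$ with the differential induced by $d$ (which squares to zero since $\Omega\in F_1$); $H_n^\bullet(\mathfrak k)$ is its cohomology. Given $\xi_n\in\mathrm{MC}(\mathfrak k/F_{n+1})$,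 it is regarded as an element of $\mathfrak k/F_{n+2}$ using a vector space decomposition $\mathfrak k/F_{n+2}\cong\mathfrak k/F_{n+1}\oplus F_{n+1}/F_{n+2}$; then $\Omega+\Omega^{\xi_n}$ lies in $F_{n+1}/F_{n+2}$ and is called the obstruction at level $n+1$. A lift of $\xi_n$ is an element mapping to it under $\mathrm{MC}(\mathfrak k/F_{n+2})\to\mathrm{MC}(\mathfrak k/F_{n+1})$.
   Formalization: The predifferential is taken to be a right derivation, d[x,y] = [x,dy] + (-1)^{|y|}[dx,y]; for a left derivation with d²η = [η,Ω] the obstruction need not be a cocycle. The base field is any field of characteristic 0. *)

(* Defs.v *)
From HB Require Import structures.
From mathcomp Require Import all_boot all_order all_algebra.
From mathcomp Require Import boolp.

Set Implicit Arguments.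
Unset Strict Implicit.
Unset Printing Implicit Defensive.

Import GRing.Theory.

Local Open Scope ring_scope.
Local Open Scope quotient_scope.

Section LinearAlgebra.
Variable k : fieldType.

Record subspace (V : lmodType k) := Subspace {
  in_sub :> {pred V};
  sub_closed : submod_closed in_sub }.

Fact subspace_semi (V : lmodType k) (W : subspace V) : subsemimod_closed W.
Proof. exact: GRing.submod_closed_semi (sub_closed W). Qed.

HB.instance Definition _ (V : lmodType k) (W : subspace V) :=
  GRing.isSubmodClosed.Build k V (in_sub W) (subspace_semi W).

Section Subtype.
Variables (V : lmodType k) (W : subspace V).

Inductive subsp : predArgType := InSub (x : V) of x \in W.

Definition sub_val (w : subsp) : V := let: InSub x _ := w in x.
HB.instance Definition _ := [isSub of subsp for sub_val].
HB.instance Definition _ := [Choice of subsp by <:].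
HB.instance Definition _ := [SubChoice_isSubZmodule of subsp by <:].
HB.instance Definition _ := [SubZmodule_isSubLmodule of subsp by <:].

Fact sub_val_is_linear : linear sub_val. Proof. by []. Qed.
HB.instance Definition _ :=
  GRing.isLinear.Build k subsp V *:%R sub_val sub_val_is_linear.

End Subtype.

Section Quotient.
Variables (V : lmodType k) (W : subspace V).

Definition quotsp : Type := Quotient.quot (in_sub W).
HB.instance Definition _ := GRing.Zmodule.on quotsp.

Definition cls (x : V) : quotsp := \pi_(Quotient.quot (in_sub W)) x.

Definition rep (X : quotsp) : V := repr (X : Quotient.quot (in_sub W)).

Lemma repK (X : quotsp) : cls (rep X) = X.
Proof. exact: reprK. Qed.

Lemma cls_eqP x y : reflect (cls x = cls y) (x - y \in W).
Proof. by rewrite (Quotient.idealrBE (in_sub W)); apply: eqP. Qed.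

Lemma cls_eq0 x : (cls x == 0) = (x \in W).
Proof.
have -> : (0 : quotsp) = cls 0 by rewrite /cls piE.
by apply/eqP/idP => [/cls_eqP|xW]; [|apply/cls_eqP]; rewrite subr0.
Qed.

Lemma rep_cls x : rep (cls x) - x \in W.
Proof. by apply/cls_eqP; rewrite repK. Qed.

Definition quot_scale (a : k) (X : quotsp) : quotsp := cls (a *: rep X).

Lemma clsD x y : cls (x + y) = cls x + cls y.
Proof. by rewrite /cls piE. Qed.

Lemma cls_scale a x : cls (a *: x) = quot_scale a (cls x).
Proof.
apply/cls_eqP; rewrite -scalerBr rpredZ // -opprB rpredN; exact: rep_cls.
Qed.

Fact quot_scaleA a b X : quot_scale a (quot_scale b X) = quot_scale (a * b) X.
Proof. by rewrite -[X]repK -!cls_scale scalerA. Qed.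

Fact quot_scale1 : left_id 1 quot_scale.
Proof. by move=> X; rewrite -[X]repK -cls_scale scale1r. Qed.

Fact quot_scaleDr : right_distributive quot_scale +%R.
Proof.
move=> a X Y; rewrite -[X]repK -[Y]repK -clsD -!cls_scale scalerDr.
exact: clsD.
Qed.

Fact quot_scaleDl X : {morph quot_scale^~ X : a b / a + b}.
Proof. by move=> a b; rewrite -[X]repK -!cls_scale scalerDl clsD. Qed.

HB.instance Definition _ := GRing.Zmodule_isLmodule.Build k quotsp
  quot_scaleA quot_scale1 quot_scaleDr quot_scaleDl.

Fact cls_is_linear : linear cls.
Proof. by move=> a x y; rewrite clsD cls_scale. Qed.
HB.instance Definition _ :=
  GRing.isLinear.Build k V quotsp *:%R cls cls_is_linear.

End Quotient.

Section QuotientMap.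
Variables (V V' : lmodType k) (W : subspace V) (W' : subspace V').
Variables (f : {linear V -> V'}) (fW : forall x, x \in W -> f x \in W').

Definition qmap of (forall x, x \in W -> f x \in W') :=
  fun X : quotsp W => cls W' (f (rep X)).

Lemma qmapE x : qmap fW (cls W x) = cls W' (f x).
Proof. by apply/cls_eqP; rewrite -linearB fW // rep_cls. Qed.

Fact qmap_is_linear : linear (qmap fW).
Proof.
move=> a X Y; rewrite -[X]repK -[Y]repK -linearP !qmapE.
by rewrite !linearP.
Qed.
HB.instance Definition _ :=
  GRing.isLinear.Build k (quotsp W) (quotsp W') *:%R (qmap fW) qmap_is_linear.

End QuotientMap.

(* The equation between degrees is an argument of the differential (and, below,
   of the bracket), so that no transport along such equations is needed. *)
Record cochain := Cochain {
  coch :> int -> lmodType k;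
  cobd : forall i j, i + 1 = j -> {linear coch i -> coch j};
  cobd_sq : forall i j l (e : i + 1 = j) (e' : j + 1 = l) (x : coch i),
    cobd e' (cobd e x) = 0 }.

Section Cohomology.
Variables (C : cochain) (i : int).

Fact cocycles_closed :
  submod_closed (fun x : C i => cobd C (erefl (i + 1)) x == 0).
Proof.
split=> [|a x y /eqP xZ /eqP yZ]; rewrite unfold_in ?linear0 //.
by rewrite linearP xZ yZ scaler0 addr0.
Qed.
Definition cocycles : subspace (C i) := Subspace cocycles_closed.

Fact coboundaries_closed : submod_closed (fun z : subsp cocycles =>
  `[< exists y : C (i - 1), cobd C (subrK 1 i) y = val z >]).
Proof.
split=> [|a x y /asboolP[u ux] /asboolP[v vy]]; apply/asboolP.
  by exists 0; rewrite !linear0.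
by exists (a *: u + v); rewrite linearP ux vy.
Qed.
Definition coboundaries : subspace (subsp cocycles) :=
  Subspace coboundaries_closed.

Definition cohomology : lmodType k := quotsp coboundaries.

Definition coh_class (z : C i) (hz : z \in cocycles) : cohomology :=
  cls coboundaries (InSub hz).

End Cohomology.

(* Signs: d is a derivation acting from the right, like [-, Omega] in
   d^2 = [-, Omega]; equivalently, eta |-> (-1)^|eta| d eta is a left derivation
   of square [Omega, -].  For a left derivation of square [-, Omega], the
   obstruction to lifting a Maurer-Cartan element need not be a cocycle. *)
Record curvedLie := CurvedLie {
  gr :> int -> lmodType k;
  br : forall i j n, i + j = n -> gr i -> gr j -> gr n;
  dd : forall i j, i + 1 = j -> {linear gr i -> gr j};
  curv : gr 2;
  br_linearl : forall i j n (e : i + j = n) (y : gr j),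
    linear (fun x => br e x y);
  br_linearr : forall i j n (e : i + j = n) (x : gr i), linear (br e x);
  br_antisym : forall i j n (e : i + j = n) (e' : j + i = n)
    (x : gr i) (y : gr j), br e x y = - ((-1) ^ (i * j) *: br e' y x);
  br_jacobi : forall i j l ij jl il n
    (eij : i + j = ij) (ejl : j + l = jl) (eil : i + l = il)
    (e1 : i + jl = n) (e2 : ij + l = n) (e3 : j + il = n)
    (x : gr i) (y : gr j) (z : gr l),
    br e1 x (br ejl y z) =
      br e2 (br eij x y) z + (-1) ^ (i * j) *: br e3 y (br eil x z);
  dd_br : forall i j n i' j' n'
    (e : i + j = n) (ei : i + 1 = i') (ej : j + 1 = j') (en : n + 1 = n')
    (e1 : i + j' = n') (e2 : i' + j = n') (x : gr i) (y : gr j),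
    dd en (br e x y) =
      br e1 x (dd ej y) + (-1) ^ j *: br e2 (dd ei x) y;
  dd_sq : forall i j l (e : i + 1 = j) (e' : j + 1 = l) (e2 : i + 2 = l)
    (x : gr i), dd e' (dd e x) = br e2 x curv;
  dd_curv : forall n (e : 2 + 1 = n), dd e curv = 0 }.

Section MaurerCartan.
Variable g : curvedLie.

Definition tw_curv (xi : g 1) : g 2 :=
  dd g (erefl 2) xi + 2^-1 *: br (erefl 2) xi xi.

Definition MC : {pred g 1} := [pred xi | curv g + tw_curv xi == 0].

End MaurerCartan.
Arguments MC g : clear implicits.

(* Only filtrations with F_0 = F_1 = g are considered; F_0 = g is then a
   consequence of fil_sub. *)
Record filtration (g : curvedLie) := Filtration {
  fil : nat -> forall i, subspace (g i);
  fil1 : forall i (x : g i), x \in fil 1 i;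
  fil_sub : forall n i (x : g i), x \in fil n.+1 i -> x \in fil n i;
  fil_br : forall p q i j n (e : i + j = n) (x : g i) (y : g j),
    x \in fil p i -> y \in fil q j -> br e x y \in fil (p + q) n;
  fil_dd : forall n i j (e : i + 1 = j) (x : g i),
    x \in fil n i -> dd g e x \in fil n j }.

Section Filtered.
Variables (g : curvedLie) (F : filtration g).

Lemma fil0 i (x : g i) : x \in fil F 0 i.
Proof. exact/fil_sub/fil1. Qed.

Section QuotientLie.
Variable n : nat.

Definition quot_br i j l (e : i + j = l) (X : quotsp (fil F n i))
    (Y : quotsp (fil F n j)) : quotsp (fil F n l) :=
  cls (fil F n l) (br e (rep X) (rep Y)).

Definition quot_dd i j (e : i + 1 = j) :
    {linear quotsp (fil F n i) -> quotsp (fil F n j)} :=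
  qmap (fil_dd (f := F) (n := n) e).

Lemma quot_brE i j l (e : i + j = l) x y :
  quot_br e (cls _ x) (cls _ y) = cls _ (br e x y).
Proof.
pose r := rep (cls (fil F n i) x); pose s := rep (cls (fil F n j) y).
have h1 : br e (r - x) s \in fil F n l.
  by rewrite -[n]addn0 fil_br ?fil0 // rep_cls.
have h2 : br e x (s - y) \in fil F n l.
  by rewrite -[n]add0n fil_br ?fil0 // rep_cls.
apply/cls_eqP; have := rpredD h1 h2.
have -> : br e (r - x) s = br e r s - br e x s.
  by rewrite [r - x]addrC -scaleN1r (br_linearl e s) scaleN1r addrC.
have -> : br e x (s - y) = br e x s - br e x y.
  by rewrite [s - y]addrC -scaleN1r (br_linearr e x) scaleN1r addrC.
by rewrite addrA subrK.
Qed.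

Lemma quot_ddE i j (e : i + 1 = j) x :
  quot_dd e (cls _ x) = cls _ (dd g e x).
Proof. exact: qmapE. Qed.

Fact quot_br_linearl i j l (e : i + j = l) (Y : quotsp (fil F n j)) :
  linear (fun X => quot_br e X Y).
Proof.
move=> a X X'; rewrite -[X]repK -[X']repK -[Y]repK -linearP !quot_brE.
by rewrite -linearP (br_linearl e).
Qed.

Fact quot_br_linearr i j l (e : i + j = l) (X : quotsp (fil F n i)) :
  linear (quot_br e X).
Proof.
move=> a Y Y'; rewrite -[X]repK -[Y]repK -[Y']repK -linearP !quot_brE.
by rewrite -linearP (br_linearr e).
Qed.

Fact quot_br_antisym i j l (e : i + j = l) (e' : j + i = l)
    (X : quotsp (fil F n i)) (Y : quotsp (fil F n j)) :
  quot_br e X Y = - ((-1) ^ (i * j) *: quot_br e' Y X).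
Proof.
rewrite -[X]repK -[Y]repK !quot_brE (br_antisym e e').
by rewrite linearN linearZ.
Qed.

Fact quot_br_jacobi i j l ij jl il m
    (eij : i + j = ij) (ejl : j + l = jl) (eil : i + l = il)
    (e1 : i + jl = m) (e2 : ij + l = m) (e3 : j + il = m)
    (X : quotsp (fil F n i)) (Y : quotsp (fil F n j))
    (Z : quotsp (fil F n l)) :
  quot_br e1 X (quot_br ejl Y Z) =
    quot_br e2 (quot_br eij X Y) Z
    + (-1) ^ (i * j) *: quot_br e3 Y (quot_br eil X Z).
Proof.
rewrite -[X]repK -[Y]repK -[Z]repK !quot_brE.
by rewrite (br_jacobi eij ejl eil e1 e2 e3) linearD linearZ.
Qed.

Fact quot_dd_br i j l i' j' l'
    (e : i + j = l) (ei : i + 1 = i') (ej : j + 1 = j') (en : l + 1 = l')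
    (e1 : i + j' = l') (e2 : i' + j = l')
    (X : quotsp (fil F n i)) (Y : quotsp (fil F n j)) :
  quot_dd en (quot_br e X Y) =
    quot_br e1 X (quot_dd ej Y) + (-1) ^ j *: quot_br e2 (quot_dd ei X) Y.
Proof.
rewrite -[X]repK -[Y]repK !(quot_brE, quot_ddE).
by rewrite (dd_br e ei ej en e1 e2) linearD linearZ.
Qed.

Fact quot_dd_sq i j l (e : i + 1 = j) (e' : j + 1 = l) (e2 : i + 2 = l)
    (X : quotsp (fil F n i)) :
  quot_dd e' (quot_dd e X) = quot_br e2 X (cls _ (curv g)).
Proof. by rewrite -[X]repK quot_brE !quot_ddE (dd_sq e e' e2). Qed.

Fact quot_dd_curv l (e : 2 + 1 = l) : quot_dd e (cls _ (curv g)) = 0.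
Proof. by rewrite quot_ddE dd_curv linear0. Qed.

Definition quotLie : curvedLie :=
  @CurvedLie (fun i => quotsp (fil F n i)) quot_br quot_dd (cls _ (curv g))
    quot_br_linearl quot_br_linearr quot_br_antisym quot_br_jacobi
    quot_dd_br quot_dd_sq quot_dd_curv.

End QuotientLie.

Fact proj_sub n i (x : g i) : x \in fil F n.+1 i -> idfun x \in fil F n i.
Proof. exact: fil_sub. Qed.

Definition proj n i : {linear quotLie n.+1 i -> quotLie n i} :=
  qmap (@proj_sub n i).

Section AssociatedGraded.
Variable n : nat.

Fact next_closed i :
  submod_closed (fun x : subsp (fil F n i) => val x \in fil F n.+1 i).
Proof.
by split=> [|a x y xF yF]; rewrite unfold_in /= ?rpred0 // rpredD // rpredZ.
Qed.
Definition next i : subspace (subsp (fil F n i)) := Subspace (@next_closed i).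

Definition res_dd i j (e : i + 1 = j) (x : subsp (fil F n i)) :
    subsp (fil F n j) := InSub (fil_dd e (valP x)).

Fact res_dd_is_linear i j (e : i + 1 = j) : linear (res_dd e).
Proof. by move=> a x y; apply: val_inj; rewrite /= !linearP. Qed.
HB.instance Definition _ i j (e : i + 1 = j) :=
  GRing.isLinear.Build k _ _ *:%R (res_dd e) (res_dd_is_linear e).

Fact res_dd_next i j (e : i + 1 = j) (x : subsp (fil F n i)) :
  x \in next i -> res_dd e x \in next j.
Proof. exact: fil_dd. Qed.

Definition assoc_dd i j (e : i + 1 = j) :
  {linear quotsp (next i) -> quotsp (next j)} := qmap (@res_dd_next i j e).

Fact assoc_dd_sq i j l (e : i + 1 = j) (e' : j + 1 = l)
  (X : quotsp (next i)) : assoc_dd e' (assoc_dd e X) = 0.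
Proof.
have e2 : i + 2 = l by rewrite -e' -e -addrA.
rewrite -[X]repK /assoc_dd /= !qmapE; apply/eqP; rewrite cls_eq0.
rewrite unfold_in /= (dd_sq e e' e2).
by have := fil_br e2 (valP (rep X)) (fil1 F (curv g)); rewrite addn1.
Qed.

Definition assoc_gr : cochain :=
  @Cochain (fun i => quotsp (next i)) assoc_dd assoc_dd_sq.

Definition incl i : {linear assoc_gr i -> quotLie n.+1 i} :=
  @qmap _ _ (next i) (fil F n.+1 i) (@sub_val _ (fil F n i)) (fun _ h => h).

Record decomposition := Decomposition {
  dec : forall i, {linear (quotLie n i * assoc_gr i)%type -> quotLie n.+1 i};
  dec_bij : forall i, bijective (dec i);
  dec_proj : forall i u, proj n i (dec i u) = u.1;
  dec_incl : forall i c, dec i (0, c) = incl i c }.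

Lemma proj_MC_eq (xi : quotLie n.+1 1) :
  proj n 2 (curv (quotLie n.+1) + tw_curv xi)
  = curv (quotLie n) + tw_curv (proj n 1 xi).
Proof.
have projE m i (x : g i) : proj m i (cls _ x) = cls _ x by exact: qmapE.
rewrite -[xi]repK projE /tw_curv /= quot_brE quot_ddE quot_brE quot_ddE.
by rewrite -!linearZ -!linearD projE.
Qed.

Lemma proj_MC (xi : quotLie n.+1 1) :
  xi \in MC (quotLie n.+1) -> proj n 1 xi \in MC (quotLie n).
Proof. by rewrite !inE -proj_MC_eq => /eqP ->; rewrite linear0. Qed.

Lemma proj_rep i (x : quotLie n.+1 i) : proj n i x = 0 -> rep x \in fil F n i.
Proof. by rewrite -[x in proj _ _ x]repK /proj /= qmapE => /eqP; rewrite cls_eq0. Qed.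

(* The preimage under incl of an element of the kernel of proj. *)
Definition in_assoc i (x : quotLie n.+1 i) (h : proj n i x = 0) : assoc_gr i :=
  cls (next i) (InSub (proj_rep h)).

Lemma in_assocE i (x : quotLie n.+1 i) (h : proj n i x = 0) :
  incl i (in_assoc h) = x.
Proof. by rewrite /incl /= qmapE repK. Qed.

Lemma incl_inj i : injective (incl i).
Proof.
move=> X Y; rewrite -[X]repK -[Y]repK /incl /= !qmapE => /cls_eqP.
by rewrite -linearB => h; apply/cls_eqP.
Qed.

Section Obstruction.
Variables (D : decomposition) (xi : quotLie n 1) (hxi : xi \in MC (quotLie n)).

Definition regarded : quotLie n.+1 1 := dec D 1 (xi, 0).

Lemma obstruction_proj :
  proj n 2 (curv (quotLie n.+1) + tw_curv regarded) = 0.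
Proof. by rewrite proj_MC_eq dec_proj; apply/eqP. Qed.

Definition obstruction : assoc_gr 2 := in_assoc obstruction_proj.

Lemma obstructionE :
  incl 2 obstruction = curv (quotLie n.+1) + tw_curv regarded.
Proof. exact: in_assocE. Qed.

End Obstruction.

End AssociatedGraded.

Definition hausdorff :=
  forall i (x : g i), (forall n, x \in fil F n i) -> x = 0.

(* Completeness is degreewise: the limit of the g / F_n is taken in graded
   spaces. *)
Definition complete :=
  forall i (x_ : forall n, quotLie n i),
    (forall n, proj n i (x_ n.+1) = x_ n) ->
  exists! x : g i, forall n, cls (fil F n i) x = x_ n.

End Filtered.

End LinearAlgebra.

Arguments MC {k} g.

(* Main.v *)
(* Write w(x) for Omega + Omega^x, in g / F_{n+1}. The Bianchi identity
   d w(x) = [x, w(x)] holds for every x of degree 1 (here [x, [x, x]] = 0 is the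
   Jacobi identity in characteristic other than 3). As [g, F_n] lies in F_{n+1},
   elements of F_n / F_{n+1} bracket to zero with everything in g / F_{n+1};
   hence the obstruction w(x) is a cocycle, and w(x + c) = w(x) + d c for c in
   F_n / F_{n+1}. The lifts are the elements x + c, so one of them is
   Maurer-Cartan exactly when w(x) is a coboundary. *)
Require Import Defs.
From mathcomp Require Import all_boot all_order all_algebra.
From mathcomp Require Import boolp.

Set Implicit Arguments.
Unset Strict Implicit.
Unset Printing Implicit Defensive.

Import GRing.Theory.

Local Open Scope ring_scope.

Section CurvedLieTheory.
Variables (k : fieldType) (g : curvedLie k).

Lemma brDl i j n (e : i + j = n) (x x' : g i) (y : g j) :
  br e (x + x') y = br e x y + br e x' y.
Proof. by have := br_linearl e y 1 x x'; rewrite !scale1r. Qed.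

Lemma brDr i j n (e : i + j = n) (x : g i) (y y' : g j) :
  br e x (y + y') = br e x y + br e x y'.
Proof. by have := br_linearr e x 1 y y'; rewrite !scale1r. Qed.

Lemma br0r i j n (e : i + j = n) (x : g i) : br e x (0 : g j) = 0.
Proof. by apply: (addrI (br e x 0)); rewrite -brDr !addr0. Qed.

Lemma brZr i j n (e : i + j = n) a (x : g i) (y : g j) :
  br e x (a *: y) = a *: br e x y.
Proof. by have := br_linearr e x a y 0; rewrite br0r !addr0. Qed.

Lemma br_odd_even n (e : 1 + 2 = n) (e' : 2 + 1 = n) (x : g 1) (y : g 2) :
  br e' y x = - br e x y.
Proof.
rewrite (br_antisym e' e) (_ : (-1) ^ (2 * 1) = 1) ?scale1r //.
by rewrite -exprnP sqrrN expr1n.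
Qed.

Hypothesis char0 : [pchar k] =i pred0.

Lemma nat_neq0 m : m.+1%:R != 0 :> k.
Proof. by rewrite ((pcharf0P k).1 char0). Qed.

Lemma br_cube (e : 1 + 2 = 3) (x : g 1) : br e x (br (erefl 2) x x) = 0.
Proof.
have e' : 2 + 1 = 3 :> int by [].
(* For b = [x, [x, x]] the Jacobi identity reads b = - b - b, so 3 b = 0. *)
have := br_jacobi (erefl 2) (erefl 2) (erefl 2) e e' e x x x.
rewrite (br_odd_even e) scaleN1r -[LHS]scale1r -!scaleN1r -scalerDl => h.
have /eqP : (3%:R : k) *: br e x (br (erefl 2) x x) = 0.
  rewrite (_ : 3%:R = 1 - (-1 - 1) :> k); first by rewrite scalerBl h subrr.
  by rewrite opprD !opprK.
by rewrite scaler_eq0 (negPf (nat_neq0 2)) => /eqP.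
Qed.

Lemma bianchi (e : 2 + 1 = 3) (e' : 1 + 2 = 3) (x : g 1) :
  dd g e (curv g + tw_curv x) = br e' x (curv g + tw_curv x).
Proof.
rewrite /tw_curv !linearD linearZZ dd_curv add0r (dd_sq _ e e').
(* The right derivation rule gives d [x, x] = [x, d x] - [d x, x] = 2 [x, d x]; the 2 cancels the
   1/2 in [tw_curv]. *)
rewrite (dd_br _ (erefl 2) (erefl 2) e e' e) (br_odd_even e').
rewrite expr1z scaleN1r opprK -mulr2n -(scaler_nat 2 (br _ _ _)).
rewrite scalerA mulVf ?nat_neq0 //.
by rewrite scale1r !brDr brZr br_cube scaler0 addr0.
Qed.

Lemma tw_curvD (x y : g 1) :
  br (erefl 2) x y = 0 -> br (erefl 2) y y = 0 ->
  tw_curv (x + y) = tw_curv x + dd g (erefl 2) y.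
Proof.
move=> xy yy; rewrite /tw_curv linearD !brDl !brDr yy xy.
by rewrite (br_antisym _ (erefl 2) y) xy scaler0 oppr0 !addr0 addrAC.
Qed.

End CurvedLieTheory.

(** Replaces the source degree [i - 1] of [coboundaries] by any [j] equal to it, so that degree 1
    can be used for [i = 2]. Proofs of equality in [int] are unique, so the differentials agree. *)
Lemma coh_class_eq0 (k : fieldType) (C : cochain k) i j (e : j + 1 = i)
    (z : C i) (hz : z \in cocycles C i) :
  coh_class hz = 0 <-> exists y : C j, cobd C e y = z.
Proof.
have ej : j = i - 1 by rewrite -e addrK.
subst j; rewrite (eq_irrelevance e (subrK 1 i)).
split=> [/eqP|h]; first by rewrite cls_eq0 => /asboolP.
by apply/eqP; rewrite cls_eq0; apply/asboolP.
Qed.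

Section AssociatedGraded.
Variables (k : fieldType) (g : curvedLie k) (F : filtration g) (n : nat).

Lemma incl_dd i j (e : i + 1 = j) (c : assoc_gr F n i) :
  incl F n j (cobd _ e c) = dd (quotLie F n.+1) e (incl F n i c).
Proof. by rewrite -[c]repK /incl /= /assoc_dd /quot_dd /= !qmapE. Qed.

Lemma br_incl i j l (e : i + j = l) (x : quotLie F n.+1 i)
  (c : assoc_gr F n j) : br e x (incl F n j c) = 0.
Proof.
rewrite -[x]repK -[c]repK /incl /= qmapE quot_brE; apply/eqP.
by rewrite cls_eq0; exact: (fil_br e (fil1 F _) (valP (rep c))).
Qed.

(** Changing the second component is a translation by the image of [incl], the setting of
    [tw_curvD]. *)
Lemma decE (D : decomposition F n) i u (c : assoc_gr F n i) :
  dec D i (u, c) = dec D i (u, 0) + incl F n i c.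
Proof. by rewrite -(dec_incl D) -linearD -[(u, 0) + _]/(_, _) addr0 add0r. Qed.

End AssociatedGraded.

Theorem theorem7p3p8 (k : fieldType) (char0 : [pchar k] =i pred0)
    (g : curvedLie k) (F : filtration g)
    (Fhausdorff : hausdorff F) (Fcomplete : complete F)
    (n : nat) (D : decomposition F n.+1)
    (xi : quotLie F n.+1 1) (hxi : xi \in MC (quotLie F n.+1)) :
  exists hz : obstruction D hxi \in cocycles (assoc_gr F n.+1) 2,
    (exists2 eta : quotLie F n.+2 1,
       eta \in MC (quotLie F n.+2) & proj F n.+1 1 eta = xi)
    <-> coh_class hz = 0.
Proof.
have hz : obstruction D hxi \in cocycles (assoc_gr F n.+1) 2.
  (* Since [incl] is injective and commutes with d, closedness can be tested in the quotient Lie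
     algebra, where the Bianchi identity applies. *)
  apply/eqP/incl_inj; rewrite incl_dd obstructionE (bianchi char0 _ (erefl 3)).
  by rewrite -(obstructionE D hxi) br_incl linear0.
exists hz; rewrite (coh_class_eq0 (erefl 2 : 1 + 1 = 2)).
(* Solving w(x) + d c = 0 for w(x) makes [- c] the primitive. *)
have MC_lift (c : assoc_gr F n.+1 1) :
    dec D 1 (xi, c) \in MC (quotLie F n.+2) <->
    cobd _ (erefl 2 : 1 + 1 = 2) (- c) = obstruction D hxi.
  rewrite inE decE tw_curvD ?br_incl // addrA -(obstructionE D hxi) -incl_dd.
  rewrite -linearD linearN; split=> [/eqP h|<-]; last by rewrite addNr linear0.
  apply/esym/eqP; rewrite -addr_eq0; apply/eqP/incl_inj.
  by rewrite h linear0.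
split=> [[eta MCeta]|[y hy]]; last first.
  by exists (dec D 1 (xi, - y)); [apply/MC_lift; rewrite opprK | rewrite dec_proj].
have [dec' _ decK] := dec_bij D 1.
(* By surjectivity of [dec D 1], [eta] comes from a pair [(u, c)], and its projection [u] must be
   [xi]. *)
rewrite -(decK eta) dec_proj in MCeta *.
case: (dec' eta) MCeta => u c /= MCeta uxi; rewrite uxi in MCeta.
by exists (- c); apply/MC_lift.
Qed.
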